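(* Let $G$ be a connected graph on $n$ vertices. Then $$\mathcal E_4^+(G)\ge \mathcal E_4^+(P_n).$$
   Context: All graphs are finite, simple, undirected and unweighted. For a graph $G$ on $n$ vertices, $A(G)$ is its $n\times n$ adjacency matrix ($0$-$1$ entries), and $\lambda_1(G),\dots,\lambda_n(G)$ are the eigenvalues of $A(G)$ counted with multiplicity. For $p>0$, the positive adjacency $p$-energy is $\mathcal E_p^+(G)=\sum_{i:\lambda_i(G)>0}\lambda_i(G)^p$; here $p=4$. $P_n$ denotes the path on $n$ vertices ($P_1$ is a single vertex). *)

(* Defs.v *)
From HB Require Import structures.
From mathcomp Require Import all_boot all_order all_algebra.
From mathcomp Require Import polyrcf.
From mathcomp Require Import reals exp.
Set Implicit Arguments.
Unset Strict Implicit.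
Unset Printing Implicit Defensive.
Import Order.TTheory GRing.Theory Num.Theory.
Local Open Scope ring_scope.

Record sgraph (n : nat) := SGraph {
  adj :> rel 'I_n;
  adj_sym : symmetric adj;
  adj_irr : irreflexive adj
}.

(* The null graph (n = 0) is not regarded as connected. *)
Definition connected_graph (n : nat) (G : sgraph n) : bool :=
  (0 < n)%N && [forall x, forall y, connect G x y].

Definition path_adj (n : nat) : rel 'I_n :=
  fun i j => (i.+1 == j :> nat) || (j.+1 == i :> nat).

Lemma path_adj_sym n : symmetric (@path_adj n).
Proof. by move=> i j; rewrite /path_adj orbC. Qed.

Lemma path_adj_irr n : irreflexive (@path_adj n).
Proof. by move=> i; rewrite /path_adj orbb eqn_leq ltnn. Qed.

Definition path_graph (n : nat) : sgraph n :=
  SGraph (@path_adj_sym n) (@path_adj_irr n).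

Definition adj_mx (R : realType) (n : nat) (G : sgraph n) : 'M[R]_n :=
  \matrix_(i, j) (G i j)%:R.

(* The list of the real eigenvalues of A, each repeated according to its
   multiplicity as a root of the characteristic polynomial.  All eigenvalues of
   a symmetric A are real, so the list is then the whole spectrum, of size n. *)
Definition spectrum (R : realType) (n : nat) (A : 'M[R]_n) : seq R :=
  flatten [seq nseq (mup x (char_poly A)) x | x <- rootsR (char_poly A)].

Lemma count_mem_spectrum (R : realType) (n : nat) (A : 'M[R]_n) (x : R) :
  count_mem x (spectrum A) = mup x (char_poly A).
Proof.
have p0 : char_poly A != 0 by exact: monic_neq0 (char_poly_monic A).
have xr : (x \in rootsR (char_poly A)) = root (char_poly A) x.
  by rewrite -(roots_on_rootsR p0) in_itv.
rewrite /spectrum count_flatten -map_comp sumnE big_map.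
have [rx|nrx] := boolP (root (char_poly A) x); last first.
  rewrite mupNroot // big1_seq // => y /andP[_ yr] /=.
  rewrite count_nseq /=; case: eqP => [yx|//].
  by move: yr; rewrite yx xr (negPf nrx).
rewrite (bigD1_seq x) /= ?xr ?uniq_roots // count_nseq /= eqxx mul1n.
rewrite big1 ?addn0 // => y yx.
by rewrite /= count_nseq /= (negPf yx) mul0n.
Qed.

Lemma mem_spectrum (R : realType) (n : nat) (A : 'M[R]_n) (x : R) :
  (x \in spectrum A) = eigenvalue A x.
Proof.
have p0 : char_poly A != 0 by exact: monic_neq0 (char_poly_monic A).
rewrite eigenvalue_root_char -has_pred1 has_count count_mem_spectrum.
by rewrite -XsubC_dvd // root_factor_theorem.
Qed.

Definition pos_energy (R : realType) (p : R) (n : nat) (G : sgraph n) : R :=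
  \sum_(x <- spectrum (adj_mx R G) | 0 < x) x `^ p.

(* Main.v *)
Require Import Defs.
From mathcomp Require Import all_boot all_order all_algebra.
From mathcomp Require Import complex.
From mathcomp Require Import reals exp.
From mathcomp Require Import ring lra zify.
Import Order.TTheory GRing.Theory Num.Theory.
Local Open Scope ring_scope.
Set Implicit Arguments.
Unset Strict Implicit.
Unset Printing Implicit Defensive.

(** Write [E A] for the sum of the fourth powers of the positive eigenvalues of
    a real symmetric matrix [A].  The path has [E = 3n - 5] (for [n >= 2]), and
    the bound [E >= 3n - 5] for connected graphs rests on two mechanisms.

    Bipartite graphs.  The spectrum is symmetric, so [2 E] is the number of
    closed 4-walks ([energy_two_colour]).  That number is at least
    [sum (2 deg^2 - deg) >= sum (5 deg - 4)], which is [6n - 10] or more because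
    a connected graph has at least [n - 1] edges; for a path with [n >= 2] all
    of these are equalities.

    Deleting a vertex.  Split [A = P - Q] into its positive and negative parts
    [P = K^2] and [Q = L^2], with [P Q = 0], so that [E A = tr P^4].  Among all
    symmetric matrices [M] with [M - A] positive semidefinite, [tr M^4] is
    smallest at [M = P] ([pos_part_min]).  Hence, if [D] is the projection
    killing the coordinate of a vertex [z], [D P D] bounds [D A D] from above
    and [E (D A D) <= tr (D P D)^4].  The difference
    [tr P^4 - tr (D P D)^4] is an explicit polynomial in the diagonal entries
    at [z] of the powers of [P] ([tr_compress4]).  The moment constraints
    [A_zz = 0], [(A^2)_zz = k = deg z] and [(A^3)_zz >= 0], together with
    Cauchy-Schwarz, force it to be at least [15/16 k^2] ([moment_bound],
    [energy_compress]).

    The two are combined by induction ([energy_ge]).  If the graph is not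
    bipartite, some vertex [z] has two neighbours that stay connected after
    [z] is removed, so removing [z] leaves at most [k - 1] pieces.  By
    induction these contribute at least [3(n - 1) - 5(k - 1)], and together
    with the gain this suffices because [15/16 k^2 - 5 k + 7 >= 0]
    for every [k]. *)

(** * Diagonalization of real symmetric matrices *)

Lemma char_poly_similar (F : fieldType) (n : nat) (P D : 'M[F]_n) :
  P \in unitmx -> char_poly (invmx P *m D *m P) = char_poly D.
Proof.
move=> uP; rewrite /char_poly.
have -> : char_poly_mx (invmx P *m D *m P)
    = map_mx polyC (invmx P) *m char_poly_mx D *m map_mx polyC P.
  rewrite /char_poly_mx mulmxBr mulmxBl -!map_mxM; congr (_ - _).
  by rewrite scalar_mxC -mulmxA -map_mxM mulVmx // map_mx1 mulmx1.
by rewrite !det_mulmx mulrAC -det_mulmx -map_mxM mulVmx // map_mx1 det1 mul1r.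
Qed.

Lemma trmx_horner (F : comNzRingType) (n : nat) (A : 'M[F]_n.+1)
    (p : {poly F}) :
  A^T = A -> (horner_mx A p)^T = horner_mx A p.
Proof.
move=> Asym; elim/poly_ind: p => [|p c IH]; first by rewrite rmorph0 trmx0.
rewrite !rmorphD !rmorphM /= horner_mx_X horner_mx_C raddfD /= tr_scalar_mx.
rewrite -[_ * A]/(_ *m A) trmx_mul IH Asym; congr (_ + _).
by apply/esym/comm_horner_mx.
Qed.

Lemma interpolation (F : fieldType) (f : F -> F) (s : seq F) :
  exists p : {poly F}, {in s, forall x, p.[x] = f x}.
Proof.
elim: s => [|y s [p Hp]]; first by exists 0.
have [ys|ys] := boolP (y \in s).
  by exists p => x; rewrite inE => /predU1P[->|]; apply: Hp.
pose q := \prod_(z <- s) ('X - z%:P).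
have qy : q.[y] != 0.
  by move: ys; rewrite -root_prod_XsubC.
exists (p + ((f y - p.[y]) / q.[y])%:P * q) => x; rewrite inE !hornerE.
case/predU1P => [->|xs]; first by rewrite divfK // addrC subrK.
have -> : q.[x] = 0 by apply/eqP; rewrite -/(root q x) root_prod_XsubC.
by rewrite mulr0 addr0 Hp.
Qed.

Lemma map_horner_mx_diag (F L : fieldType) (f : {rmorphism F -> L}) (n : nat)
    (A : 'M[F]_n.+1) (d : 'rV[F]_n.+1) (U : 'M[L]_n.+1) (p : {poly F}) :
  U \in unitmx -> map_mx f A = invmx U *m map_mx f (diag_mx d) *m U ->
  map_mx f (horner_mx A p)
    = invmx U *m map_mx f (diag_mx (map_mx (horner p) d)) *m U.
Proof.
move=> uU fA; rewrite map_horner_mx fA horner_mx_uconjC //.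
by rewrite -map_horner_mx horner_mx_diag.
Qed.

(** The unitary diagonalization of the complexified matrix is enough: only the
    values and traces of real polynomials in [A] are needed, and these descend
    from [R[i]] to [R]. *)
Lemma complex_diagonalization (R : realType) (n : nat) (A : 'M[R]_n) :
  A^T = A ->
  exists (U : 'M[R[i]]_n) (d : 'rV[R]_n), U \in unitmx /\
    map_mx (real_complex R) A
      = invmx U *m map_mx (real_complex R) (diag_mx d) *m U.
Proof.
move=> Asym; set B := map_mx _ A.
have Bsym : B \is symmetricmx.
  apply/is_hermitianmxP; rewrite expr0 scale1r map_mx_id //.
  by rewrite /B map_trmx Asym.
have Breal : B \is a mxOver Num.real.
  by apply/mxOverP => i j; rewrite mxE complex_real.
have Bherm := realsym_hermsym Bsym Breal.
have /mxOverP dreal := hermitian_spectral_diag_real Bherm.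
have /orthomx_spectralP Beq := hermitian_normalmx Bherm.
exists (spectralmx B), (map_mx (@complex.Re R) (spectral_diag B)).
split; first exact: spectral_unit.
rewrite map_diag_mx.
have -> : map_mx (real_complex R) (map_mx (@complex.Re R) (spectral_diag B))
    = spectral_diag B.
  by apply/rowP => i; rewrite !mxE; apply: RRe_real.
exact: Beq.
Qed.

(** Spectral calculus without eigenvectors: a polynomial in [A] is determined by
    its values on the spectrum, which is all that is required to define square
    roots of the positive and negative parts. *)
Lemma real_spectral (R : realType) (n : nat) (A : 'M[R]_n.+1) : A^T = A ->
  exists d : 'rV[R]_n.+1,
    [/\ perm_eq (spectrum A) [seq d 0 i | i : 'I_n.+1],
        forall p, \tr (horner_mx A p) = \sum_i p.[d 0 i]
      & forall p, (forall i, p.[d 0 i] = 0) -> horner_mx A p = 0].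
Proof.
move=> /complex_diagonalization [U [d [uU fA]]].
have hE p := map_horner_mx_diag p uU fA.
exists d; split.
- apply/allP => x _ /=; apply/eqP; rewrite count_mem_spectrum.
  suff -> : char_poly A = \prod_(y <- [seq d 0 i | i : 'I_n.+1]) ('X - y%:P).
    by rewrite mu_prod_XsubC.
  apply: (map_poly_inj (real_complex R)); rewrite map_char_poly fA.
  rewrite char_poly_similar // -map_char_poly.
  rewrite char_poly_trig ?diag_mx_is_trig // big_map big_enum; congr map_poly.
  by apply: eq_bigr => i _; rewrite mxE eqxx.
- move=> p; apply: (fmorph_inj (real_complex R)); rewrite -trace_map_mx hE.
  rewrite mxtrace_mulC mulmxA mulmxV // mul1mx trace_map_mx.
  rewrite mxtrace_diag; congr (real_complex R _).
  by apply: eq_bigr => i _; rewrite mxE.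
- move=> p p0; apply: (map_mx_inj (f := real_complex R)); rewrite hE map_mx0.
  have -> : map_mx (horner p) d = 0.
    by apply/rowP => i; rewrite !mxE; apply: p0.
  by rewrite raddf0 map_mx0 mulmx0 mul0mx.
Qed.

(** * Positive parts and their minimality *)

Definition energy (R : realType) (n : nat) (A : 'M[R]_n) : R :=
  \sum_(x <- spectrum A | 0 < x) x ^+ 4.

(** [K] and [L] are the square roots of the positive and negative parts.  Having
    the roots themselves turns every positivity statement below into a sum of
    squares. *)
Lemma pos_part_decomposition (R : realType) (n : nat) (A : 'M[R]_n.+1) :
  A^T = A ->
  exists K L : 'M[R]_n.+1,
    [/\ K^T = K, L^T = L, A = K ^+ 2 - L ^+ 2, K * L = 0 /\ L * K = 0
      & energy A = \tr (K ^+ 8)].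
Proof.
move=> Asym; have [d [Ed trE vanish]] := real_spectral Asym.
have [k kE] := interpolation (fun x : R => Num.sqrt x) (codom (d 0)).
have [l lE] := interpolation (fun x : R => Num.sqrt (- x)) (codom (d 0)).
have {}kE i : k.[d 0 i] = Num.sqrt (d 0 i) by apply/kE/codom_f.
have {}lE i : l.[d 0 i] = Num.sqrt (- d 0 i) by apply/lE/codom_f.
exists (horner_mx A k), (horner_mx A l).
have kl0 i : Num.sqrt (d 0 i) * Num.sqrt (- d 0 i) = 0.
  have [d0|d0] := leP (d 0 i) 0; first by rewrite ler0_sqrtr // mul0r.
  by rewrite mulrC ler0_sqrtr ?mul0r // oppr_le0 ltW.
split; [exact: trmx_horner|exact: trmx_horner| | |].
- apply/eqP; rewrite -subr_eq0; apply/eqP.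
  rewrite -[X in X - _](horner_mx_X A) -!rmorphXn -!rmorphB; apply: vanish => i.
  rewrite !hornerE kE lE.
  have [d0|d0] := leP (d 0 i) 0.
    by rewrite [Num.sqrt (d 0 i)]ler0_sqrtr // sqr_sqrtr ?oppr_ge0 //; ring.
  rewrite [Num.sqrt (- _)]ler0_sqrtr ?oppr_le0 1?ltW //.
  by rewrite sqr_sqrtr 1?ltW //; ring.
- by split; rewrite -rmorphM; apply: vanish => i; rewrite hornerM kE lE //
     mulrC.
- rewrite -rmorphXn trE /energy (perm_big _ Ed) /= big_map big_mkcond.
  rewrite big_enum /=.
  apply: eq_bigr => i _; rewrite !hornerE kE.
  have [d0|d0] := ltP 0 (d 0 i); last by rewrite ler0_sqrtr // expr0n.
  by rewrite -[8%N]/(2 * 4)%N exprM sqr_sqrtr // ltW.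
Qed.

Lemma tr_gram_ge0 (F : realDomainType) (n : nat) (X : 'M[F]_n.+1) :
  0 <= \tr (X^T * X).
Proof.
apply: sumr_ge0 => i _; rewrite mxE; apply: sumr_ge0 => j _.
by rewrite mxE -expr2 sqr_ge0.
Qed.

Lemma trmxM (F : comNzRingType) (n : nat) (X Y : 'M[F]_n.+1) :
  (X * Y)^T = Y^T * X^T.
Proof. exact: trmx_mul. Qed.

Lemma trmxB (F : comNzRingType) (n : nat) (X Y : 'M[F]_n.+1) :
  (X - Y)^T = X^T - Y^T.
Proof. exact: raddfB. Qed.

Lemma trmxX (F : comNzRingType) (n : nat) (X : 'M[F]_n.+1) k :
  (X ^+ k)^T = X^T ^+ k.
Proof. by elim: k => [|k IH]; rewrite ?trmx1 // exprS trmxM IH -exprSr. Qed.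

Lemma mxtrace_mulrC (F : comNzRingType) (n : nat) (X Y : 'M[F]_n.+1) :
  \tr (X * Y) = \tr (Y * X).
Proof. exact: mxtrace_mulC. Qed.

Lemma mulX_eq0 (F : pzRingType) (K L : F) i j :
  K * L = 0 -> K ^+ i.+1 * L ^+ j.+1 = 0.
Proof.
by move=> KL; rewrite exprSr exprS mulrA -(mulrA _ K) KL mulr0 mul0r.
Qed.

Lemma sqrB_orthogonal (F : pzRingType) (K L : F) i j :
  K * L = 0 -> L * K = 0 ->
  (K ^+ i.+1 - L ^+ j.+1) ^+ 2 = K ^+ (i.+1 * 2) + L ^+ (j.+1 * 2).
Proof.
move=> KL LK; rewrite !exprM !expr2 mulrBl !mulrBr.
by rewrite (mulX_eq0 _ _ KL) (mulX_eq0 _ _ LK) subr0 sub0r opprK.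
Qed.

(** Young's inequality [4 x y^3 <= x^4 + 3 y^4] for traces; it is the sum of the
    squared Frobenius norms [|M P - P^2|^2] and [|M^2 - P^2|^2], so [M] need not
    be positive. *)
Lemma young_trace (F : realFieldType) (n : nat) (M P : 'M[F]_n.+1) :
  M^T = M -> P^T = P ->
  4 * \tr (M * P ^+ 3) <= \tr (M ^+ 4) + 3 * \tr (P ^+ 4).
Proof.
move=> Ms Ps.
have h1 : 0 <= \tr (M ^+ 2 * P ^+ 2) - 2 * \tr (M * P ^+ 3) + \tr (P ^+ 4).
  have /le_trans := tr_gram_ge0 (M * P - P ^+ 2); apply.
  rewrite trmxB trmxM trmxX Ms Ps mulrBl !mulrBr !raddfB /=.
  have -> : \tr (P * M * (M * P)) = \tr (M ^+ 2 * P ^+ 2).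
    by rewrite -mulrA mxtrace_mulrC -!mulrA -expr2 !mulrA -expr2.
  have -> : \tr (P * M * P ^+ 2) = \tr (M * P ^+ 3).
    by rewrite -mulrA mxtrace_mulrC -mulrA -exprSr.
  have -> : \tr (P ^+ 2 * (M * P)) = \tr (M * P ^+ 3).
    by rewrite mxtrace_mulrC -mulrA -exprS.
  by rewrite -exprD; lra.
have h2 : 0 <= \tr (M ^+ 4) - 2 * \tr (M ^+ 2 * P ^+ 2) + \tr (P ^+ 4).
  have /le_trans := tr_gram_ge0 (M ^+ 2 - P ^+ 2); apply.
  rewrite trmxB !trmxX Ms Ps mulrBl !mulrBr !raddfB /=.
  by rewrite [\tr (P ^+ 2 * M ^+ 2)]mxtrace_mulrC -!exprD; lra.
lra.
Qed.

(** With [P = K^2] and [A = K^2 - L^2], [tr P^4 = tr (A P^3) <= tr (M P^3)],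
    since [M - A] and [P^3] are positive semidefinite; Young's inequality
    concludes.  Positivity of [M - A] is expressed by a Gram factorization. *)
Lemma pos_part_min (F : realFieldType) (n : nat) (K L M Z : 'M[F]_n.+1) :
  K^T = K -> L * K = 0 -> M^T = M ->
  M - (K ^+ 2 - L ^+ 2) = Z^T * Z -> \tr (K ^+ 8) <= \tr (M ^+ 4).
Proof.
move=> Ks LK Ms MZ.
have K2s : (K ^+ 2)^T = K ^+ 2 by rewrite trmxX Ks.
have := young_trace Ms K2s; rewrite -!exprM.
have : 0 <= \tr (M * K ^+ 6) - \tr (K ^+ 8).
  have /le_trans := tr_gram_ge0 (Z * K ^+ 3); apply.
  rewrite trmxM trmxX Ks -mulrA mxtrace_mulrC (mulrA Z^T) -MZ.
  rewrite -mulrA -exprD !mulrBl !raddfB /= -exprD.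
  by rewrite [L ^+ 2]expr2 exprS -mulrA (mulrA L K) LK mul0r mulr0 raddf0; lra.
rewrite -[(2 * 3)%N]/6%N -[(2 * 4)%N]/8%N; lra.
Qed.

Lemma energy_min (R : realType) (n : nat) (A M Z : 'M[R]_n.+1) :
  A^T = A -> M^T = M -> M - A = Z^T * Z -> energy A <= \tr (M ^+ 4).
Proof.
move=> /pos_part_decomposition [K [L [Ks _ AE [_ LK] ->]]] Ms.
by rewrite AE => /(pos_part_min Ks LK Ms).
Qed.

(** Conjugation by [D] exchanges the positive part of [A] with that of [- A];
    minimality, applied in both directions, shows that the two have the same
    fourth moment, and together they make up [tr A^4]. *)
Lemma energy_bipartite (R : realType) (n : nat) (A D : 'M[R]_n.+1) :
  A^T = A -> D^T = D -> D * D = 1 -> D * A * D = - A ->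
  2 * energy A = \tr (A ^+ 4).
Proof.
move=> As Ds DD DAD.
have [K [L [Ks Ls AE [KL LK] eA]]] := pos_part_decomposition As.
have conj4 X : \tr ((D * X ^+ 2 * D) ^+ 4) = \tr (X ^+ 8).
  have DXX Y W : D * Y * D * (D * W * D) = D * (Y * W) * D.
    by rewrite !mulrA -(mulrA (D * Y)) DD mulr1.
  rewrite -[8%N]/(2 * 4)%N exprM; move: (X ^+ 2) => Y.
  rewrite -[4%N]/(2 * 2)%N !exprM !(expr2 (D * Y * D)) DXX expr2 DXX.
  by rewrite mxtrace_mulrC !mulrA DD mul1r !expr2 !mulrA.
have conjs X : X^T = X -> (D * X ^+ 2 * D)^T = D * X ^+ 2 * D.
  by move=> Xs; rewrite trmxM (trmxM D) trmxX Ds Xs mulrA.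
have gram X : X^T = X -> (X * D)^T * (X * D) = D * X ^+ 2 * D.
  by move=> Xs; rewrite trmxM Ds Xs expr2 !mulrA.
have DAE : D * L ^+ 2 * D - D * K ^+ 2 * D = A.
  by rewrite -[RHS]opprK -DAD AE mulrBr mulrBl opprB.
have le1 : \tr (K ^+ 8) <= \tr (L ^+ 8).
  rewrite -[leRHS]conj4.
  apply: (@pos_part_min _ _ K L _ (K * D)); rewrite ?conjs // gram // -AE.
  by rewrite -DAE opprB addrC subrK.
have le2 : \tr (L ^+ 8) <= \tr (K ^+ 8).
  rewrite -[leRHS]conj4.
  apply: (@pos_part_min _ _ L K _ (L * D)); rewrite ?conjs // gram //.
  by rewrite -(opprB (K ^+ 2)) -AE opprK -DAE addrC subrK.
have A4 : A ^+ 4 = K ^+ 8 + L ^+ 8.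
  rewrite -[4%N]/(2 * 2)%N exprM AE sqrB_orthogonal // expr2.
  rewrite mulrDl !mulrDr (mulX_eq0 _ _ KL) (mulX_eq0 _ _ LK) addr0 add0r.
  by rewrite -!exprD.
by rewrite eA A4 raddfD /=; lra.
Qed.

(** * The gain from deleting a coordinate *)

Lemma mul_delta_entry (F : comNzRingType) (n : nat) (X Y : 'M[F]_n.+1) z :
  (X * delta_mx z z * Y) z z = X z z * Y z z.
Proof.
rewrite -[_ * Y]/(_ *m Y) -[X * _]/(X *m _) mxE (bigD1 z) //= big1 => [|i iz].
  rewrite addr0 mxE (bigD1 z) //= big1 => [|i iz]; rewrite !mxE.
    by rewrite !eqxx mulr1 addr0.
  by rewrite (negPf iz) mulr0.
rewrite mxE big1 ?mul0r // => j _; rewrite !mxE (negPf iz) andbF mulr0 //.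
Qed.

Lemma tr_mul_delta (F : comNzRingType) (n : nat) (X : 'M[F]_n.+1) z :
  \tr (X * delta_mx z z) = X z z.
Proof.
rewrite mxtrace_mulrC /mxtrace (bigD1 z) //= big1 => [|i iz];
  rewrite -[_ * _]/(_ *m _) mxE.
  rewrite addr0 (bigD1 z) //= big1 => [|j jz]; rewrite !mxE !eqxx.
    by rewrite mul1r addr0.
  by rewrite (negPf jz) mul0r.
by rewrite big1 // => j _; rewrite !mxE (negPf iz) mul0r.
Qed.

(** The words [P^i D P^j D ...] are expanded from the right: since [D] is the
    identity minus a rank-one projection, each [D] splits an entry at [z] into a
    joined term and a product of two shorter entries. *)
Lemma tr_compress4 (F : comNzRingType) (n : nat) (P D : 'M[F]_n.+1) z :
  D = 1 - delta_mx z z ->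
  \tr ((D * P * D) ^+ 4) = \tr (P ^+ 4) - 4 * (P ^+ 4) z z
    + 4 * P z z * (P ^+ 3) z z + 2 * (P ^+ 2) z z ^+ 2
    - 4 * P z z ^+ 2 * (P ^+ 2) z z + P z z ^+ 4.
Proof.
move=> DE; set E := delta_mx z z in DE.
have EE : E * E = E by rewrite /E -[_ * _]/(_ *m _) mul_delta_mx.
have DD : D * D = D.
  by rewrite DE mulrBr mulr1 mulrBl mul1r EE subrr subr0.
have trD X : \tr (X * D) = \tr X - X z z.
  by rewrite DE mulrBr mulr1 raddfB /= tr_mul_delta.
have cD X Y : (X * D * Y) z z = (X * Y) z z - X z z * Y z z.
  rewrite DE mulrBr mulr1 mulrBl -mul_delta_entry.
  by rewrite [LHS]mxE [X in _ + X]mxE.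
have pow3 (X : 'M[F]_n.+1) : X ^+ 3 = X * X * X.
  by rewrite !exprS expr0 mulr1 mulrA.
have pow4 (X : 'M[F]_n.+1) : X ^+ 4 = X * X * X * X.
  by rewrite !exprS expr0 mulr1 !mulrA.
have -> : \tr ((D * P * D) ^+ 4)
    = \tr (P * D * P * D * P * D * P * D).
  rewrite pow4 !mulrA -!(mulrA _ D D) !DD mxtrace_mulrC !mulrA DD -!mulrA.
  by rewrite mxtrace_mulrC !mulrA.
have cyc X : \tr (X * P * D) = \tr (P * X) - (X * P) z z.
  by rewrite trD mxtrace_mulrC.
have e1 : (P * D * P) z z = (P ^+ 2) z z - P z z ^+ 2 by rewrite cD.
have e2 : (P * P * D * P) z z = (P ^+ 3) z z - (P ^+ 2) z z * P z z.
  by rewrite cD pow3.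
have e3 : (P * D * P * P) z z = (P ^+ 3) z z - (P ^+ 2) z z * P z z.
  by rewrite -(mulrA _ P P) cD pow3 mulrA mulrC.
have e4 : (P * D * P * D * P) z z
    = (P ^+ 3) z z - 2 * (P ^+ 2) z z * P z z + P z z ^+ 3.
  by rewrite cD e3 e1; ring.
have w1 : (P * P * P * D * P) z z = (P ^+ 4) z z - (P ^+ 3) z z * P z z.
  by rewrite cD pow3 pow4.
have w2 : (P * P * D * P * D * P) z z = (P ^+ 4) z z - (P ^+ 2) z z ^+ 2
    - (P ^+ 3) z z * P z z + (P ^+ 2) z z * P z z ^+ 2.
  rewrite cD e2 -(mulrA (P * P * D)) cD (mulrA (P * P)) -pow4 -[P * P]expr2.
  ring.
have e5 : (P * D * P * P * P) z z = (P ^+ 4) z z - P z z * (P ^+ 3) z z.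
  by rewrite -(mulrA (P * D * P)) -(mulrA (P * D)) cD !mulrA -pow4 -pow3.
have w3 : (P * D * P * D * P * D * P) z z
    = (P ^+ 4) z z - 2 * P z z * (P ^+ 3) z z - (P ^+ 2) z z ^+ 2
      + 3 * P z z ^+ 2 * (P ^+ 2) z z - P z z ^+ 4.
  rewrite cD e4 -(mulrA (P * D * P * D)) cD e1 !mulrA e5; rewrite -[P * P]expr2.
  ring.
rewrite cyc !mulrA cyc !mulrA cyc !mulrA trD -pow4 w1 w2 w3; ring.
Qed.

(** Here [a], [p2], [p3], [p4] are the moments at [z] of the positive part and
    [a], [n2], [n3] those of the negative part.  If [p2 = n2 = k/2] and all
    the mass sits at two opposite points of size [sqrt k], then the right-hand
    side is exactly [15/16 k^2].  An asymmetric distribution costs more: a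
    smaller [p2] enlarges [n2], hence [n3], hence [p3] and [p4].  With
    [u = a p3] and [w = a^2 p2], the substance is a lower bound for
    [p4 + w - u], where [p4 >= u^2 / w] and [u >= max(p2, n2)^2]. *)
Lemma moment_bound (F : realFieldType) (a p2 p3 p4 n2 n3 k : F) :
  0 < k -> k = p2 + n2 -> 0 <= a -> 0 <= p2 -> 0 <= n2 -> n3 <= p3 ->
  p2 ^+ 2 <= a * p3 -> n2 ^+ 2 <= a * n3 -> p3 ^+ 2 <= p2 * p4 ->
  a ^+ 2 * k <= p2 * n2 ->
  15 / 16 * k ^+ 2 <=
    4 * p4 - 4 * a * p3 - 2 * p2 ^+ 2 + 4 * a ^+ 2 * p2 - a ^+ 4.
Proof.
move=> k0 kE a0 p20 n20 n3p3 hp2 hn2 hp3 bessel.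
have a_gt0 : 0 < a.
  rewrite lt_neqAle a0 andbT eq_sym; apply/eqP => aE; move: hp2 hn2.
  rewrite aE !mul0r => hp hn; have := sqr_ge0 (p2 - n2).
  by have := mulr_gt0 k0 k0; rewrite kE; nra.
have c_gt0 : 0 < a ^+ 2 * k by rewrite mulr_gt0 ?exprn_gt0.
have p2_gt0 : 0 < p2.
  rewrite lt_neqAle p20 andbT eq_sym; apply/eqP => E.
  by move: bessel; rewrite E mul0r leNgt c_gt0.
have n2_gt0 : 0 < n2.
  rewrite lt_neqAle n20 andbT eq_sym; apply/eqP => E.
  by move: bessel; rewrite E mulr0 leNgt c_gt0.
set u := a * p3 in hp2 *; set w := a ^+ 2 * p2.
have w_gt0 : 0 < w by rewrite mulr_gt0 ?exprn_gt0.
have n2u : n2 ^+ 2 <= u by apply: le_trans hn2 _; rewrite ler_pM2l.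
have wp4 : u ^+ 2 <= w * p4.
  by rewrite /u /w exprMn -mulrA ler_pM2l ?exprn_gt0.
have kw : k * w <= p2 ^+ 2 * n2.
  have -> : k * w = a ^+ 2 * k * p2 by rewrite /w; ring.
  have -> : p2 ^+ 2 * n2 = p2 * n2 * p2 by ring.
  by rewrite ler_pM2r.
have a4 : a ^+ 4 <= k ^+ 2 / 16.
  have h : a ^+ 2 <= k / 4.
    rewrite -(ler_pM2r k0); apply: le_trans bessel _; rewrite kE.
    have := sqr_ge0 (p2 - n2); nra.
  have -> : k ^+ 2 / 16 = (k / 4) ^+ 2 by field.
  by rewrite -[4%N]/(2 * 2)%N exprM lerXn2r // nnegrE ?sqr_ge0 //; lra.
(* the tangent line of [u^2 / w], which keeps the estimate linear in [u], [w] *)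
have tangent r : 2 * u * r - r ^+ 2 * w <= p4.
  rewrite -subr_ge0 -(pmulr_rge0 _ w_gt0); have := sqr_ge0 (u - r * w); nra.
have bound r s h : 2 <= r -> r * s = 1 -> 0 <= s -> r * w <= h -> h <= u ->
    (r + s - 1) * h <= p4 + w - u.
  move=> r2 rs s0 rwh hu.
  have rw2 : r ^+ 2 * w - w <= (r - s) * h.
    have -> : r ^+ 2 * w - w = (r - s) * (r * w).
      by rewrite mulrBl !mulrA [s * r]mulrC rs mul1r.
    by rewrite ler_wpM2l // subr_ge0; nra.
  have := tangent r; have : (2 * r - 1) * h <= (2 * r - 1) * u.
    by rewrite ler_wpM2l //; lra.
  lra.
suff : k ^+ 2 / 4 <= p4 + w - u - p2 ^+ 2 / 2 by rewrite /u /w; lra.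
(* in each case [r = h / w] at the extremal values [h = max(p2, n2)^2] of [u]
   and [w = p2^2 n2 / k] *)
have [np|pn] := leP n2 p2.
  pose r := k / n2; pose s := n2 / k.
  have r2 : 2 <= r by rewrite /r ler_pdivlMr //; lra.
  have rs : r * s = 1 by rewrite /r /s; field; rewrite !gt_eqF.
  have s0 : 0 <= s by rewrite divr_ge0 // ltW.
  have rw : r * w <= p2 ^+ 2.
    by rewrite -(ler_pM2r n2_gt0) mulrAC /r divfK ?gt_eqF.
  have := bound r s _ r2 rs s0 rw hp2.
  have : 5 / 2 * p2 ^+ 2 <= (r + s) * p2 ^+ 2.
    have s2 : s <= 2^-1 by rewrite /s ler_pdivrMr //; lra.
    by rewrite ler_wpM2r ?sqr_ge0 //; nra.
  have : k ^+ 2 <= 4 * p2 ^+ 2 by rewrite kE; nra.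
  lra.
pose r := n2 * k / p2 ^+ 2; pose s := p2 ^+ 2 / (n2 * k).
have r2 : 2 <= r.
  by rewrite /r ler_pdivlMr ?exprn_gt0 // kE; nra.
have rs : r * s = 1 by rewrite /r /s; field; rewrite !gt_eqF.
have s0 : 0 <= s by rewrite divr_ge0 ?mulr_ge0 ?exprn_ge0 // ltW.
have rw : r * w <= n2 ^+ 2.
  have -> : r * w = n2 / p2 ^+ 2 * (k * w) by rewrite /r; ring.
  have -> : n2 ^+ 2 = n2 / p2 ^+ 2 * (p2 ^+ 2 * n2) by field; rewrite gt_eqF.
  by rewrite ler_wpM2l // divr_ge0 // sqr_ge0.
have sn : p2 ^+ 2 / 2 <= s * n2 ^+ 2.
  have -> : s * n2 ^+ 2 = p2 ^+ 2 * (n2 / k).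
    by rewrite /s; field; rewrite !gt_eqF.
  rewrite ler_pM2l ?exprn_gt0 // ler_pdivlMr //; lra.
have := bound r s _ r2 rs s0 rw n2u.
have : 2 * n2 ^+ 2 <= r * n2 ^+ 2 by rewrite ler_wpM2r ?sqr_ge0.
have : k ^+ 2 <= 4 * n2 ^+ 2 by rewrite kE; nra.
lra.
Qed.

Lemma sum_CS (F : realFieldType) (I : finType) (x y : I -> F) :
  (\sum_i x i * y i) ^+ 2 <= (\sum_i x i ^+ 2) * (\sum_i y i ^+ 2).
Proof.
set b := \sum_i x i * y i; set a := \sum_i _; set c := \sum_i _.
have quad s t : 0 <= s ^+ 2 * a - 2 * s * t * b + t ^+ 2 * c.
  have -> : s ^+ 2 * a - 2 * s * t * b + t ^+ 2 * c
      = \sum_i (s * x i - t * y i) ^+ 2.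
    rewrite !mulr_sumr -sumrB -big_split; apply: eq_bigr => i _ /=; ring.
  by apply: sumr_ge0 => i _; apply: sqr_ge0.
have a0 : 0 <= a by apply: sumr_ge0 => i _; apply: sqr_ge0.
have [aE|a_neq0] := eqVneq a 0.
  have [->|b0] := eqVneq b 0; first by rewrite aE mul0r expr0n.
  have := quad ((c + 1) / (2 * b)) 1.
  have -> : 2 * ((c + 1) / (2 * b)) * 1 * b = c + 1 by field.
  by rewrite aE; lra.
rewrite -subr_ge0 -(pmulr_rge0 _ (_ : 0 < a)); last first.
  by rewrite lt_neqAle eq_sym a_neq0.
have := quad b a; lra.
Qed.

Lemma gram_entryE (F : comNzRingType) (n : nat) (X Y : 'M[F]_n.+1) z :
  X^T = X -> (X * Y) z z = \sum_i X i z * Y i z.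
Proof.
move=> Xs; rewrite -[X * Y]/(X *m Y) mxE; apply: eq_bigr => i _.
by rewrite -{1}Xs mxE.
Qed.

Lemma gram_entry_ge0 (F : realDomainType) (n : nat) (X : 'M[F]_n.+1) z :
  X^T = X -> 0 <= (X ^+ 2) z z.
Proof.
move=> Xs; rewrite expr2 gram_entryE //; apply: sumr_ge0 => i _.
by rewrite -expr2 sqr_ge0.
Qed.

Lemma gram_entry_CS (F : realFieldType) (n : nat) (X Y : 'M[F]_n.+1) z :
  X^T = X -> Y^T = Y ->
  (X * Y) z z ^+ 2 <= (X ^+ 2) z z * (Y ^+ 2) z z.
Proof.
move=> Xs Ys; rewrite !expr2 !gram_entryE // -expr2.
exact: (sum_CS (X^~ z) (Y^~ z)).
Qed.

(** Bessel's inequality for the basis vector at [z] against the orthogonal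
    columns [X e_z] and [Y e_z]; this is how the total mass 1 of the spectral
    measure at [z] enters the argument. *)
Lemma gram_entry_bessel (F : realFieldType) (n : nat) (X Y : 'M[F]_n.+1) z :
  X^T = X -> Y^T = Y -> X * Y = 0 -> X z z = Y z z ->
  X z z ^+ 2 * ((X ^+ 2) z z + (Y ^+ 2) z z) <= (X ^+ 2) z z * (Y ^+ 2) z z.
Proof.
move=> Xs Ys XY aE.
set a := X z z; set p := (X ^+ 2) z z; set q := (Y ^+ 2) z z.
have p0 : 0 <= p by apply: gram_entry_ge0.
have q0 : 0 <= q by apply: gram_entry_ge0.
have ap : a ^+ 2 <= p.
  have := gram_entry_CS z (trmx1 F n.+1) Xs.
  by rewrite mul1r expr1n mxE eqxx mul1r.
have aq : a ^+ 2 <= q.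
  have := gram_entry_CS z (trmx1 F n.+1) Ys.
  by rewrite mul1r expr1n mxE eqxx mul1r /a aE.
have [pq0|pq_gt0] := leP (p * q) 0.
  have : p * q = 0 by apply/eqP; rewrite eq_le pq0 mulr_ge0.
  move/eqP; rewrite mulf_eq0 => /orP[]/eqP E.
    suff -> : a ^+ 2 = 0 by rewrite mul0r mulr_ge0.
    by apply/eqP; rewrite eq_le sqr_ge0 andbT -E.
  suff -> : a ^+ 2 = 0 by rewrite mul0r mulr_ge0.
  by apply/eqP; rewrite eq_le sqr_ge0 andbT -E.
rewrite -subr_ge0 -(pmulr_rge0 _ pq_gt0).
have : 0 <= \sum_i ((p * q) * (1 : 'M[F]_n.+1) i z - (a * q) * X i z
                      - (a * p) * Y i z) ^+ 2.
  by apply: sumr_ge0 => i _; apply: sqr_ge0.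
set S := \sum_i _; suff -> : S = p * q * (p * q - a ^+ 2 * (p + q)) by [].
have sXX : \sum_i X i z ^+ 2 = p.
  by rewrite /p expr2 gram_entryE.
have sYY : \sum_i Y i z ^+ 2 = q.
  by rewrite /q expr2 gram_entryE.
have sXY : \sum_i X i z * Y i z = 0 by rewrite -gram_entryE // XY mxE.
have s1X : \sum_i (1 : 'M[F]_n.+1) i z * X i z = a.
  by rewrite -gram_entryE ?trmx1 // mul1r.
have s1Y : \sum_i (1 : 'M[F]_n.+1) i z * Y i z = a.
  by rewrite -gram_entryE ?trmx1 // mul1r /a aE.
have s11 : \sum_i (1 : 'M[F]_n.+1) i z ^+ 2 = 1.
  transitivity ((1 * 1 : 'M[F]_n.+1) z z); last by rewrite mul1r mxE eqxx.
  by rewrite gram_entryE ?trmx1.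
have -> : S = (p * q) ^+ 2 * \sum_i (1 : 'M[F]_n.+1) i z ^+ 2
    + (a * q) ^+ 2 * \sum_i X i z ^+ 2 + (a * p) ^+ 2 * \sum_i Y i z ^+ 2
    - 2 * (p * q) * (a * q) * \sum_i (1 : 'M[F]_n.+1) i z * X i z
    - 2 * (p * q) * (a * p) * \sum_i (1 : 'M[F]_n.+1) i z * Y i z
    + 2 * (a * q) * (a * p) * \sum_i X i z * Y i z.
  rewrite !mulr_sumr -!big_split -!sumrB -!big_split /=.
  by apply: eq_bigr => i _; ring.
rewrite sXX sYY sXY s1X s1Y s11; ring.
Qed.

(** For an adjacency matrix, [(A ^+ 2) z z] is the degree of [z] and
    [(A ^+ 3) z z] counts the closed 3-walks at [z]. *)
Lemma energy_compress (R : realType) (n : nat) (A D : 'M[R]_n.+1) z :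
  A^T = A -> D = 1 - delta_mx z z ->
  A z z = 0 -> 0 < (A ^+ 2) z z -> 0 <= (A ^+ 3) z z ->
  energy (D * A * D) + 15 / 16 * (A ^+ 2) z z ^+ 2 <= energy A.
Proof.
move=> As DE A1 A2 A3.
have [K [L [Ks Ls AE [KL LK] eA]]] := pos_part_decomposition As.
have Ds : D^T = D by rewrite DE trmxB trmx1 trmx_delta.
have K2s : (K ^+ 2)^T = K ^+ 2 by rewrite trmxX Ks.
have L2s : (L ^+ 2)^T = L ^+ 2 by rewrite trmxX Ls.
have le1 : energy (D * A * D) <= \tr ((D * K ^+ 2 * D) ^+ 4).
  apply: (@energy_min _ _ _ _ (L * D)).
  - by rewrite trmxM (trmxM D) Ds As mulrA.
  - by rewrite trmxM (trmxM D) Ds K2s mulrA.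
  - rewrite -mulrBl -mulrBr AE opprB addrC subrK.
    by rewrite trmxM Ds Ls expr2 !mulrA.
have A2E : A ^+ 2 = K ^+ 4 + L ^+ 4 by rewrite AE sqrB_orthogonal.
have A3E : A ^+ 3 = K ^+ 6 - L ^+ 6.
  rewrite exprS A2E AE mulrBl !mulrDr (mulX_eq0 _ _ KL) (mulX_eq0 _ _ LK).
  by rewrite addr0 add0r -!exprD.
have diag : (K ^+ 2) z z = (L ^+ 2) z z.
  by apply/eqP; rewrite -subr_eq0 -A1 AE !mxE.
have CS (X : 'M[R]_n.+1) i j : X^T = X ->
    (X ^+ (i + j)) z z ^+ 2 <= (X ^+ (i * 2)) z z * (X ^+ (j * 2)) z z.
  by move=> Xs; rewrite exprD !exprM; apply: gram_entry_CS; rewrite trmxX Xs.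
have ge0 (X : 'M[R]_n.+1) i : X^T = X -> 0 <= (X ^+ (i * 2)) z z.
  by move=> Xs; rewrite exprM; apply: gram_entry_ge0; rewrite trmxX Xs.
have kE : (A ^+ 2) z z = (K ^+ 4) z z + (L ^+ 4) z z by rewrite A2E mxE.
have bessel := gram_entry_bessel K2s L2s (mulX_eq0 1 1 KL) diag.
have := tr_compress4 (K ^+ 2) DE.
have := @moment_bound _ ((K ^+ 2) z z) ((K ^+ 4) z z) ((K ^+ 6) z z)
  ((K ^+ 8) z z) ((L ^+ 4) z z) ((L ^+ 6) z z) _ A2 kE
  (ge0 K 1%N Ks) (ge0 K 2%N Ks) (ge0 L 2%N Ls).
rewrite -!exprM in bessel *; rewrite -[(2 * 2)%N]/4%N in bessel *.
rewrite kE in bessel *.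
move=> /(_ _ (CS K 1%N 3%N Ks) _ (CS K 2%N 4%N Ks) bessel).
rewrite -[(2 * 4)%N]/8%N -[(2 * 3)%N]/6%N eA.
have n3 : (L ^+ 6) z z <= (K ^+ 6) z z.
  by rewrite -subr_ge0; move: A3; rewrite A3E !mxE.
have n2 : (L ^+ 4) z z ^+ 2 <= (K ^+ 2) z z * (L ^+ 6) z z.
  by rewrite diag; apply: (CS L 1%N 3%N Ls).
move=> /(_ n3 n2) mb tc; move: le1; rewrite tc.
lra.
Qed.

(** * Counting closed walks of length four *)

Definition degree (T : finType) (e : rel T) (x : T) : nat := #|[set y | e x y]|.

Definition codegree (T : finType) (e : rel T) (x y : T) : nat :=
  #|[set w | e x w && e w y]|.

(** A closed 4-walk is a pair of 2-walks with common ends. *)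
Definition closed_walks4 (T : finType) (e : rel T) : nat :=
  (\sum_x \sum_y codegree e x y ^ 2)%N.

Lemma degreeE (T : finType) (e : rel T) x : degree e x = (\sum_y e x y)%N.
Proof.
rewrite /degree -sum1dep_card big_mkcond; apply: eq_bigr => y _.
by case: e.
Qed.

Lemma codegreeE (T : finType) (e : rel T) x y :
  codegree e x y = (\sum_w e x w * e w y)%N.
Proof.
rewrite /codegree -sum1dep_card big_mkcond; apply: eq_bigr => w _.
by case: (e x w); case: (e w y).
Qed.

Lemma codegree_diag (T : finType) (e : rel T) x :
  symmetric e -> codegree e x x = degree e x.
Proof.
move=> e_sym; apply: eq_card => w.
by rewrite !inE (e_sym w x) andbb.
Qed.

Lemma sum_codegree (T : finType) (e : rel T) : symmetric e ->
  (\sum_x \sum_y codegree e x y = \sum_x degree e x ^ 2)%N.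
Proof.
move=> e_sym; under eq_bigr => x _.
  under eq_bigr => y _ do rewrite codegreeE.
  rewrite exchange_big /=.
  under eq_bigr => w _ do rewrite -big_distrr -degreeE /=.
  over.
rewrite exchange_big; apply: eq_bigr => w _ /=.
rewrite -big_distrl -mulnn /= degreeE; congr (_ * _)%N.
by apply: eq_bigr => x _; rewrite e_sym.
Qed.

Lemma sum_codegree_split (T : finType) (e : rel T) (f : nat -> nat) :
  symmetric e ->
  (\sum_x \sum_y f (codegree e x y)
    = \sum_x f (degree e x) + \sum_x \sum_(y | y != x) f (codegree e x y))%N.
Proof.
move=> e_sym; rewrite -big_split; apply: eq_bigr => x _ /=.
by rewrite (bigD1 x) //= codegree_diag.
Qed.

(** Each off-diagonal codegree is a natural number, hence at most its square. *)
Lemma closed_walks4_ge (T : finType) (e : rel T) : symmetric e ->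
  (2 * (\sum_x degree e x ^ 2) <= closed_walks4 e + \sum_x degree e x)%N.
Proof.
move=> e_sym; have := sum_codegree_split id e_sym; rewrite /= sum_codegree //.
rewrite /closed_walks4 (sum_codegree_split (expn^~ 2%N) e_sym).
have : (\sum_x \sum_(y | y != x) codegree e x y
    <= \sum_x \sum_(y | y != x) codegree e x y ^ 2)%N.
  do 2!(apply: leq_sum => ? _); case: codegree => // k; exact: leq_pmull.
rewrite /=; lia.
Qed.

Lemma closed_walks4_eq (T : finType) (e : rel T) : symmetric e ->
  (forall x y, x != y -> codegree e x y <= 1)%N ->
  (closed_walks4 e + \sum_x degree e x = 2 * (\sum_x degree e x ^ 2))%N.
Proof.
move=> e_sym cn1; have := sum_codegree_split id e_sym.
rewrite /= sum_codegree //.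
rewrite /closed_walks4 (sum_codegree_split (expn^~ 2%N) e_sym).
have -> : (\sum_x \sum_(y | y != x) codegree e x y ^ 2
    = \sum_x \sum_(y | y != x) codegree e x y)%N.
  apply: eq_bigr => x _; apply: eq_bigr => y yx.
  by have := cn1 x y; rewrite eq_sym => /(_ yx); case: codegree => [|[]].
lia.
Qed.

Definition rel_mx (R : pzSemiRingType) (n : nat) (e : rel 'I_n) : 'M[R]_n :=
  \matrix_(i, j) (e i j)%:R.

Lemma rel_mx_sym (R : pzSemiRingType) (n : nat) (e : rel 'I_n) :
  symmetric e -> (rel_mx R e)^T = rel_mx R e.
Proof. by move=> e_sym; apply/matrixP => i j; rewrite !mxE e_sym. Qed.

Lemma rel_mx_sqr (R : comNzRingType) (n : nat) (e : rel 'I_n.+1) x y :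
  (rel_mx R e ^+ 2) x y = (codegree e x y)%:R.
Proof.
rewrite expr2 -[_ * _]/(_ *m _) mxE codegreeE natr_sum; apply: eq_bigr => w _.
by rewrite !mxE natrM.
Qed.

Lemma tr_rel_mx4 (R : comNzRingType) (n : nat) (e : rel 'I_n.+1) :
  symmetric e -> \tr (rel_mx R e ^+ 4) = (closed_walks4 e)%:R.
Proof.
move=> e_sym.
rewrite -[4%N]/(2 + 2)%N exprD -[_ * _]/(_ *m _) /mxtrace natr_sum.
apply: eq_bigr => x _; rewrite mxE natr_sum; apply: eq_bigr => y _.
rewrite -{2}(rel_mx_sym R e_sym) -trmxX [X in _ * X]mxE !rel_mx_sqr -expr2.
by rewrite natrX.
Qed.

Definition delete_vertex (T : eqType) (e : rel T) (z : T) : rel T :=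
  fun x y => [&& e x y, x != z & y != z].

Lemma compress_rel_mx (R : comNzRingType) (n : nat) (e : rel 'I_n.+1) z :
  let D := 1 - delta_mx z z in
  D * rel_mx R e * D = rel_mx R (delete_vertex e z).
Proof.
move=> D; have DE : D = diag_mx (\row_i (i != z)%:R).
  apply/matrixP => i j; rewrite !mxE; have [->|ij] := eqVneq i j.
    by case: eqP => _; rewrite ?subrr ?subr0.
  rewrite mulr0n sub0r; have [iz|_] := eqVneq i z; last by rewrite oppr0.
  by have [jz|] := eqVneq j z; [rewrite iz jz eqxx in ij | rewrite oppr0].
rewrite DE -[_ * _ * _]/(_ *m _ *m _) mul_mx_diag mul_diag_mx.
apply/matrixP => i j; rewrite !mxE -!natrM /delete_vertex; congr (_%:R).
by case: (e i j); case: (i != z); case: (j != z).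
Qed.

Lemma energy_two_colour (R : realType) (n : nat) (e : rel 'I_n.+1)
    (c : 'I_n.+1 -> bool) :
  symmetric e -> (forall x y, e x y -> c x != c y) ->
  2 * energy (rel_mx R e) = (closed_walks4 e)%:R.
Proof.
move=> e_sym ce; rewrite -(tr_rel_mx4 _ e_sym).
pose D : 'M[R]_n.+1 := diag_mx (\row_i (-1) ^+ c i).
apply: (@energy_bipartite _ _ _ D); first exact: rel_mx_sym.
- by rewrite tr_diag_mx.
- rewrite -[D * D]/(D *m D) mulmx_diag -[RHS]/(1%:M) -diag_const_mx.
  by congr diag_mx; apply/rowP => i; rewrite !mxE -expr2 sqrr_sign.
- rewrite -[_ * _ * _]/(_ *m _ *m _) mul_mx_diag mul_diag_mx.
  apply/matrixP => i j; rewrite !mxE.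
  have := ce i j; case: (e i j) => [/(_ isT)|_]; last first.
    by rewrite mulr0 mul0r oppr0.
  by case: (c i); case: (c j) => // _; rewrite !(expr0, expr1, mulr1, mul1r).
Qed.

(** * Connectivity and distances *)

Lemma delete_vertex_sym (T : finType) (e : rel T) z :
  symmetric e -> symmetric (delete_vertex e z).
Proof.
move=> e_sym x y.
by rewrite /delete_vertex e_sym [(x != z) && _]andbC.
Qed.

(** A path from [x] either avoids [z] or first meets it through a neighbour of
    [z]. *)
Lemma connect_delete (T : finType) (e : rel T) x y z : symmetric e ->
  connect e x y -> x != z ->
  y != z /\ connect (delete_vertex e z) x y \/
  exists2 w, e z w & connect (delete_vertex e z) x w.
Proof.
move=> e_sym /connectP[p]; elim: p x => [|w p IH] x /=.
  by move=> _ -> xz; left; rewrite xz connect0.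
case/andP => exw pw yE xz; have [wz|wz] := eqVneq w z.
  by right; exists x; [rewrite e_sym -wz | apply: connect0].
have step : connect (delete_vertex e z) x w.
  by apply: connect1; rewrite /delete_vertex exw xz wz.
case: (IH w pw yE wz) => [[yz wy]|[v zv wv]]; [left|right].
  by split=> //; apply: connect_trans wy.
by exists v => //; apply: connect_trans wv.
Qed.

(** [d] is the distance to [Rt] along [e], on the vertices of [S]; the three
    clauses are what breadth-first search provides. *)
Lemma distance_to_set (T : finType) (e : rel T) (S Rt : {set T}) :
  symmetric e ->
  (forall x y, e x y -> x \in S) ->
  (forall x, x \in S -> exists2 r, r \in Rt & connect e x r) ->
  exists d : T -> nat, forall x, x \in S ->
    [/\ d x = 0%N -> x \in Rt,
        forall m, d x = m.+1 -> exists2 y, e x y & d y = m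
      & forall y, e x y -> (d y <= (d x).+1)%N].
Proof.
move=> e_sym eS reach.
pose walk x k := [exists p : k.-tuple T, path e x p && (last x p \in Rt)].
have walkS x y k : e x y -> walk y k -> walk x k.+1.
  move=> exy /existsP[p /andP[yp lp]]; apply/existsP; exists (cons_tuple y p).
  by rewrite /= exy yp.
have : forall x, exists k, x \in S ->
    walk x k /\ forall j, walk x j -> (k <= j)%N.
  move=> x; have [xS|_] := boolP (x \in S); last by exists 0%N.
  have ex : exists k, walk x k.
    have [r rR /connectP[p xp rE]] := reach x xS.
    by exists (size p); apply/existsP; exists (in_tuple p); rewrite /= xp -rE.
  by case: (ex_minnP ex) => k wk kmin; exists k.
move/fin_all_exists => [d dP]; exists d => x xS.
have [wx xmin] := dP x xS; split.
- move=> dx; move: wx; rewrite dx => /existsP[p /andP[_]].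
  by rewrite tuple0.
- move=> m dx; move: wx; rewrite dx => /existsP[p].
  case/tupleP: p => y p /= /andP[/andP[exy yp] lp].
  have yS : y \in S by apply: (eS y x); rewrite e_sym.
  have [wy ymin] := dP y yS; exists y => //.
  have wym : walk y m by apply/existsP; exists p; rewrite yp.
  apply/eqP; rewrite eqn_leq ymin //= -ltnS -dx.
  by apply: xmin; apply: walkS wy.
- move=> y exy; have yS : y \in S by apply: (eS y x); rewrite e_sym.
  have [_] := dP y yS; apply; apply: walkS wx; by rewrite e_sym.
Qed.

(** Every vertex of [S] outside [Rt] owns the edge to a parent nearer to [Rt],
    and the degree sum counts each such edge from both ends. *)
Lemma sum_degree_ge (T : finType) (e : rel T) (S Rt : {set T}) (d : T -> nat) :
  symmetric e ->
  (forall x, x \in S -> x \notin Rt -> exists2 y, e x y & (d y < d x)%N) ->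
  (2 * #|S| <= \sum_x degree e x + 2 * #|Rt|)%N.
Proof.
move=> e_sym parent.
pose down := (\sum_x \sum_y (e x y && (d y < d x)))%N.
have down_ge : (#|S| <= down + #|Rt|)%N.
  have : (#|S :\: Rt| <= down)%N.
    rewrite -sum1_card big_mkcond; apply: leq_sum => x _.
    case: ifP => //; rewrite inE => /andP[xR xS].
    have [y exy yx] := parent x xS xR.
    by rewrite (bigD1 y) //= exy yx.
  have := cardsID Rt S; have := subset_leq_card (subsetIr S Rt); lia.
have up : (\sum_x \sum_y (e x y && (d x < d y)))%N = down.
  rewrite exchange_big; apply: eq_bigr => x _; apply: eq_bigr => y _.
  by rewrite e_sym.
have : (down + down <= \sum_x degree e x)%N.
  rewrite -{2}up -big_split; apply: leq_sum => x _ /=.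
  rewrite -big_split degreeE; apply: leq_sum => y _ /=.
  by case: (e x y) => //=; case: ltngtP.
lia.
Qed.

(** * The lower bound for connected graphs *)

(** The parity of [d] is a two-colouring, so twice the energy is the number of
    closed 4-walks; the vertexwise estimate is [deg^2 + 2 >= 3 deg]. *)
Lemma energy_distance_coloured (R : realType) (n : nat) (e : rel 'I_n.+1)
    (S Rt : {set 'I_n.+1}) (d : 'I_n.+1 -> nat) :
  symmetric e -> (forall x y, e x y -> x \in S) ->
  (forall x, x \in S ->
    [/\ d x = 0%N -> x \in Rt,
        forall m, d x = m.+1 -> exists2 y, e x y & d y = m
      & forall y, e x y -> (d y <= (d x).+1)%N]) ->
  (forall x y, e x y -> d x != d y) ->
  3 * #|S|%:R - 5 * #|Rt|%:R <= energy (rel_mx R e).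
Proof.
move=> e_sym eS dP dne.
have colour x y : e x y -> odd (d x) != odd (d y).
  move=> exy; have yx : e y x by rewrite e_sym.
  have [_ _ /(_ y exy)] := dP x (eS _ _ exy).
  have [_ _ /(_ x yx)] := dP y (eS _ _ yx).
  have := dne x y exy; rewrite neq_ltn => /orP[] lt le1 le2.
    have -> : d y = (d x).+1 by apply/eqP; rewrite eqn_leq le2.
    by rewrite /=; case: odd.
  have -> : d x = (d y).+1 by apply/eqP; rewrite eqn_leq le1.
  by rewrite /=; case: odd.
have dbl := energy_two_colour R e_sym colour.
have sumdeg : (2 * #|S| <= \sum_x degree e x + 2 * #|Rt|)%N.
  apply: (sum_degree_ge e_sym (d := d)) => x xS xR.
  have [d0 dS _] := dP x xS; case dx: (d x) => [|m].
    by rewrite d0 in xR.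
  by have [y exy dy] := dS m dx; exists y => //; rewrite dy.
have quad : (3 * (\sum_x degree e x) <= \sum_x degree e x ^ 2 + 2 * #|S|)%N.
  rewrite -sum1_card !big_distrr /= [X in (_ <= _ + X)%N]big_mkcond -big_split.
  apply: leq_sum => x _ /=; case: ifP => xS.
    by case: (degree e x) => [|[|k]] //; rewrite -mulnn; nia.
  suff -> : degree e x = 0%N by [].
  apply: eq_card0 => y; rewrite inE; apply/negP => exy.
  by rewrite (eS _ _ exy) in xS.
have := closed_walks4_ge e_sym => walks.
have : (6 * #|S| <= closed_walks4 e + 10 * #|Rt|)%N by lia.
rewrite -(ler_nat R) natrD !natrM -dbl; lra.
Qed.

(** With one root per component, the bound is [3 |S| - 5 c] for [c] components.
    Deleting a vertex may disconnect the graph; allowing any set of roots that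
    meets every component avoids counting components: after [z] is deleted, its
    neighbours become the new roots in place of one old root, and one of them is
    redundant. *)
Lemma energy_ge (R : realType) (n : nat) (e : rel 'I_n.+1)
    (S Rt : {set 'I_n.+1}) :
  symmetric e -> irreflexive e -> (forall x y, e x y -> x \in S) ->
  (forall x, x \in S -> exists2 r, r \in Rt & connect e x r) ->
  3 * #|S|%:R - 5 * #|Rt|%:R <= energy (rel_mx R e).
Proof.
have [s] := ubnP #|S|; elim: s => // s IHs in e S Rt *.
have [t] := ubnP #|Rt|; elim: t => // t IHt in Rt *.
move=> Rt_le S_le e_sym e_irr eS reach.
have csym := sym_connect_sym e_sym.
(* two roots of one component: drop one of them *)
have [/existsP[r /existsP[r' /and4P[rR r'R rr' crr']]]|/existsPn Rt_free] :=
  boolP [exists r, exists r',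
    [&& r \in Rt, r' \in Rt, r != r' & connect e r r']].
  have card_r : #|Rt| = #|Rt :\ r'|.+1 by rewrite (cardsD1 r') r'R.
  have : 3 * #|S|%:R - 5 * #|Rt :\ r'|%:R <= energy (rel_mx R e).
    apply: IHt => //; first by rewrite -ltnS -card_r.
    move=> x xS; have [r1 r1R xr1] := reach x xS.
    have [r1r'|r1r'] := eqVneq r1 r'; last by exists r1; rewrite // !inE r1r'.
    exists r; first by rewrite !inE rr'.
    by apply: (connect_trans xr1); rewrite r1r' csym.
  by apply: le_trans; rewrite card_r -natr1; lra.
have {}Rt_free r r' : r \in Rt -> r' \in Rt -> connect e r r' -> r = r'.
  move=> rR r'R crr'; apply/eqP; apply: contraT => rr'.
  by have /existsPn/(_ r') := Rt_free r; rewrite rR r'R rr' crr'.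
have [d dP] := distance_to_set e_sym eS reach.
have [/existsP[z /existsP[u' /andP[zu' /eqP dzu]]]|/existsPn no_eq] :=
    boolP [exists x, exists y, e x y && (d x == d y)]; last first.
  apply: (energy_distance_coloured _ e_sym eS dP) => x y exy.
  by have /existsPn/(_ y) := no_eq x; rewrite exy.
(* From here on, [z] and [u'] are adjacent and equally far from [Rt]; below, [u]
   is the parent of [z].  Both [u] and [u'] descend to [Rt] without meeting
   [z], so they stay connected once [z] is deleted. *)
have zS := eS _ _ zu'.
have u'z : e u' z by rewrite e_sym.
have u'S := eS _ _ u'z.
have u'Dz : u' != z by apply: contraTneq zu' => ->; rewrite e_irr.
pose e' := delete_vertex e z.
have sub_e' : subrel (connect e') (connect e).
  by apply: connect_sub => x y /and3P[exy _ _]; apply: connect1.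
have descend w : w \in S -> w != z -> (d w <= d z)%N ->
    exists2 r, r \in Rt & connect e' w r.
  have [m] := ubnP (d w); elim: m => // m IHm in w *.
  move=> dw wS wz dwz; have [d0 dS _] := dP w wS.
  case dwE: (d w) => [|l]; first by exists w; [apply: d0 | apply: connect0].
  have [v wv dv] := dS l dwE.
  have vS : v \in S by apply: (eS v w); rewrite e_sym.
  have vz : v != z by apply: contraTneq dwz => vz; rewrite dwE -dv vz ltnn.
  have [||r rR vr] := IHm v _ vS vz;
    [by rewrite dv -ltnS -dwE|by rewrite dv ltnW // -dwE|].
  by exists r => //; apply: connect_trans vr; apply: connect1; apply/and3P.
case dz: (d z) => [|m].
  have [d0z _ _] := dP z zS; have [d0u _ _] := dP u' u'S.
  have : z = u' by apply: Rt_free; rewrite ?d0z ?d0u -?dzu // connect1.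
  by move/eqP; rewrite eq_sym (negPf u'Dz).
have [_ /(_ m dz) [u zu du] _] := dP z zS.
have uz : e u z by rewrite e_sym.
have uS := eS _ _ uz.
have uDz : u != z by apply: contraTneq zu => ->; rewrite e_irr.
have uDu' : u != u'.
  by apply: contra_eq_neq du => ->; rewrite -dzu dz neq_ltn ltnSn orbT.
have uu' : connect e' u u'.
  have [|r rR ur] := descend u uS uDz; first by rewrite du dz.
  have [|r' r'R u'r'] := descend u' u'S u'Dz; first by rewrite dzu.
  have rr' : r = r'.
    apply: Rt_free => //; apply: (@connect_trans _ _ u).
      by rewrite csym; apply: sub_e'.
    apply: (connect_trans (connect1 uz)); apply: (connect_trans (connect1 zu')).
    exact: sub_e'.
  have csym' := sym_connect_sym (delete_vertex_sym z e_sym).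
  by apply: (connect_trans ur); rewrite csym' rr'.
have [r0 r0R zr0] := reach z zS.
pose N := [set y | e z y].
pose Rt' := Rt :\ r0 :|: N :\ u.
have reach' x : x \in S :\ z -> exists2 r, r \in Rt' & connect e' x r.
  rewrite !inE => /andP[xz xS].
  have viaN w : e z w -> connect e' x w ->
      exists2 r, r \in Rt' & connect e' x r.
    move=> zw xw; have [wu|wu] := eqVneq w u.
      exists u'; first by rewrite !inE zu' (eq_sym u' u) uDu' orbT.
      by apply: (connect_trans xw); rewrite wu.
    by exists w; rewrite // !inE wu zw orbT.
  have [r1 r1R xr1] := reach x xS.
  case: (connect_delete e_sym xr1 xz) => [[_ xr1']|[w zw xw]]; last first.
    exact: viaN xw.
  have [r10|r10] := eqVneq r1 r0; last by exists r1; rewrite // !inE r10 r1R.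
  have xz' : connect e x z by apply: (connect_trans xr1); rewrite r10 csym.
  case: (connect_delete e_sym xz' xz) => [[]|[w zw xw]]; last exact: viaN xw.
  by rewrite eqxx.
have step : 3 * #|S :\ z|%:R - 5 * #|Rt'|%:R <= energy (rel_mx R e').
  apply: IHs => //.
  - by rewrite -ltnS; have := cardsD1 z S; rewrite zS add1n => <-.
  - exact: delete_vertex_sym.
  - by move=> x; rewrite /e' /delete_vertex e_irr.
  - by move=> x y /and3P[exy xz _]; rewrite !inE xz (eS _ _ exy).
have cardS : #|S| = #|S :\ z|.+1 by rewrite (cardsD1 z) zS.
have kE : degree e z = #|N| by [].
have k2 : (2 <= degree e z)%N.
  by rewrite kE; apply/card_gt1P; exists u, u'; rewrite !inE.
have cardR : (#|Rt'| + 2 <= #|Rt| + degree e z)%N.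
  apply: (leq_trans (leq_add (leq_card_setU _ _).1 (leqnn 2))).
  rewrite kE (cardsD1 r0 Rt) (cardsD1 u N) r0R inE zu.
  by rewrite !(add1n, addSn, addnS, addn0).
have := @energy_compress R n (rel_mx R e) _ z (rel_mx_sym R e_sym) erefl.
rewrite compress_rel_mx -/e' rel_mx_sqr // codegree_diag // mxE e_irr.
rewrite ltr0n => /(_ erefl (ltnW k2)) gain.
have A3 : 0 <= (rel_mx R e ^+ 3) z z.
  rewrite exprS expr2 -[_ * (_ * _)]/(_ *m (_ *m _)) mxE.
  apply: sumr_ge0 => i _.
  by rewrite !mxE mulr_ge0 ?sumr_ge0 // => j _; rewrite !mxE mulr_ge0.
have := gain A3; move: step cardR; rewrite cardS -(ler_nat R) !natrD -natr1.
(* [15/16 (k - 8/3)^2 <= 15/16 k^2 - 5 k + 7] *)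
set k := (degree e z)%:R; have := sqr_ge0 (k - 8 / 3).
set E' := energy _; set E := energy _; lra.
Qed.

(** * The path, and the comparison with connected graphs *)

Lemma pos_energy4 (R : realType) (n : nat) (G : sgraph n) :
  pos_energy (4 : R) G = energy (rel_mx R G).
Proof.
apply: eq_bigr => x x0.
by rewrite powR_mulrn // ltW.
Qed.

(** Interior vertices contribute [2 deg^2 - deg = 6] and the two ends 1 each. *)
Lemma closed_walks4_path (n : nat) :
  (closed_walks4 (@path_adj n.+2) + 10 <= 6 * n.+2)%N.
Proof.
pose e := @path_adj n.+2.
have cn1 x y : x != y -> (codegree e x y <= 1)%N.
  rewrite -val_eqE /= => xy; apply/card_le1_eqP => v w.
  rewrite !inE /e /path_adj => /andP[xv vy] /andP[xw wy]; apply: val_inj => /=.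
  move: xy xv vy xw wy => /eqP xy.
  by do 4!(case/orP => /eqP ?); lia.
have deg2 x : (degree e x <= 2)%N.
  apply: (@leq_trans #|[set (inord x.-1 : 'I_n.+2); inord x.+1]|); last first.
    by rewrite cards2; case: (_ != _).
  apply/subset_leq_card/subsetP => y; rewrite !inE /e /path_adj.
  case/orP => /eqP E; apply/orP; [right|left].
    by rewrite E inord_val.
  by rewrite -E /= inord_val.
have deg0 : (degree e ord0 <= 1)%N.
  apply: (@leq_trans #|[set (inord 1 : 'I_n.+2)]|); last by rewrite cards1.
  apply/subset_leq_card/subsetP => y; rewrite !inE /e /path_adj /=.
  by case/orP => /eqP // ->; rewrite inord_val.
have degM : (degree e ord_max <= 1)%N.
  apply: (@leq_trans #|[set (inord n : 'I_n.+2)]|); last by rewrite cards1.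
  apply/subset_leq_card/subsetP => y; rewrite !inE /e /path_adj /=.
  case/orP => /eqP E; last first.
    by case: E => yn; rewrite -val_eqE /= inordK // yn.
  by have := ltn_ord y; rewrite -E ltnn.
have := closed_walks4_eq (@path_adj_sym n.+2) cn1.
have : (\sum_(x : 'I_n.+2)
      (2 * degree e x ^ 2 + (5 * (x == ord0) + 5 * (x == ord_max)))
    <= \sum_x (degree e x + 6))%N.
  apply: leq_sum => x _; have [->|x0] := eqVneq x ord0.
    by case: (degree e ord0) deg0 => [|[]].
  have [->|xM] := eqVneq x ord_max.
    by case: (degree e ord_max) degM => [|[]].
  by case: (degree e x) (deg2 x) => [|[|[]]].
have point (a : 'I_n.+2) : (\sum_(x : 'I_n.+2) (x == a))%N = 1%N.
  by rewrite (bigD1 a) //= eqxx big1 // => x /negPf->.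
rewrite !big_split /= !point !sum_nat_const card_ord -/e; lia.
Qed.

Unset Implicit Arguments.

Theorem theorem3p6 (R : realType) (n : nat) (G : sgraph n)
    (hG : connected_graph G) :
  pos_energy (4 : R) G >= pos_energy (4 : R) (path_graph n).
Proof.
rewrite !pos_energy4; case: n G hG => [|n] G /andP[// _ /forallP conn].
have dblP : 2 * energy (rel_mx R (path_graph n.+1))
    = (closed_walks4 (@path_adj n.+1))%:R.
  apply: (@energy_two_colour _ _ _ (fun i : 'I_n.+1 => odd i)).
    exact: path_adj_sym.
  by move=> x y /orP[]/eqP <- /=; case: odd.
case: n G conn dblP => [|n] G conn dblP.
  have walks0 : closed_walks4 (@path_adj 1) = 0%N.
    apply: big1 => x _; apply: big1 => y _.
    suff -> : codegree (@path_adj 1) x y = 0%N by [].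
    by apply: eq_card0 => w; rewrite !inE [x]ord1 [w]ord1 path_adj_irr.
  have : 0 <= energy (rel_mx R G).
    by apply: sumr_ge0 => x x0; rewrite exprn_ge0 // ltW.
  by rewrite walks0 in dblP; lra.
have ge : 3 * #|[set: 'I_n.+2]|%:R - 5 * #|[set (ord0 : 'I_n.+2)]|%:R
    <= energy (rel_mx R G).
  apply: energy_ge;
    [exact: adj_sym|exact: adj_irr|by move=> x y _; rewrite inE|].
  by move=> x _; exists ord0; [rewrite inE | have /forallP := conn x; apply].
have := closed_walks4_path n; rewrite -(ler_nat R) natrD natrM -dblP.
by move: ge; rewrite cardsT card_ord cards1; lra.
Qed.
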